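(* Let $G$ be a countable discrete group and let $\mathcal{T}$ be the canonical partial translation structure on $G$. Then the partial translation algebra $C^*(\mathcal{T})$ is canonically isomorphic to the reduced group $C^*$-algebra $C^*_r(G)$.
   Context: $G$ is equipped with a proper left-invariant (hence bounded geometry) metric $d$. For $g\in G$ let $t_g=\{(x,xg): x\in G\}\subseteq G\times G$, and for $R>0$ let $\mathcal{T}_R=\{t_g: d(e,g)<R\}$. The canonical partial translation structure on $G$ is $\mathcal{T}=\bigcup_{R>0}\mathcal{T}_R$. A partial bijection $t\subseteq X\times X$ of a metric space $X$ (a subset on which both coordinate projections are injective) with $d(x,y)$ bounded for $(x,y)\in t$ is called a partial translation; it is viewed as the partial isometry on $l^2(X)$ with $\delta_y\mapsto\delta_x$ if $(x,y)\in t$, and $\delta_y\mapsto 0$ if no such $x$ exists. It lies in the uniform Roe algebra $C^*_u(X)$, the norm closure in $B(l^2(X))$ of the bounded operators $T=(T(x,y))$ of finite propagation (i.e. for which there is $R$ with $T(x,y)=0$ whenever $d(x,y)>R$). The partial translation algebra $C^*(\mathcal{T})$ is the $C^*$-subalgebra of $C^*_u(X)$ generated by the elements $t\in\mathcal{T}$ viewed as partial isometries. $C^*_r(G)$ is the $C^*$-algebra given by the closure of the left regular representation of $G$ on $l^2(G)$. ''Canonically'' refers to the isomorphism given by conjugation by the unitary on $l^2(G)$ with $\delta_g\mapsto\delta_{g^{-1}}$. *)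

(* Defs.v *)
From HB Require Import structures.
From mathcomp Require Import all_boot all_order all_algebra.
From mathcomp Require Import mathcomp_extra boolp classical_sets functions.
From mathcomp Require Import cardinality fsbigop reals ereal topology.
From mathcomp Require Import normedtype numfun esum complex ring lra.

Set Implicit Arguments.
Unset Strict Implicit.
Unset Printing Implicit Defensive.

Import Order.TTheory GRing.Theory Num.Theory.
Import numFieldNormedType.Exports.
Import Normc.

Local Open Scope classical_set_scope.
Local Open Scope ring_scope.

Section real_sums.
Context {R : realType} {X : choiceType}.
Implicit Types (f g h : X -> R).

Definition rsummable f := summable [set: X] (EFin \o f).

(* Sum of an absolutely summable real family, as the difference of the sums of
   its positive and negative parts; all uses below are on summable families. *)
Definition rsum f : R :=
  fine (esum [set: X] ((EFin \o f)^\+)%E) - fine (esum [set: X] ((EFin \o f)^\-)%E).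

Lemma esum_fin f : (forall x, 0 <= f x) -> rsummable f ->
  (\esum_(x in [set: X]) (f x)%:E)%E \is a fin_num.
Proof.
move=> f0; rewrite /rsummable summableE.
rewrite (@eq_esum _ _ _ (fun x => `|(f x)%:E|%E) (fun x => (f x)%:E))//.
by move=> x _; rewrite abse_EFin ger0_norm.
Qed.

Lemma rsummable_le f g :
  (forall x, `|f x| <= g x) -> rsummable g -> rsummable f.
Proof.
move=> fg; apply: le_lt_trans; apply: le_esum => x _.
by rewrite !abse_EFin lee_fin (le_trans (fg x))// ler_norm.
Qed.

Lemma esum_bound f (M : R) : (forall x, 0 <= f x) ->
  (forall s : seq X, uniq s -> \sum_(x <- s) f x <= M) ->
  (\esum_(x in [set: X]) (f x)%:E <= M%:E)%E.
Proof.
move=> f0 fM; apply: ge_ereal_sup => _ [F [finF _] <-].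
by rewrite fsbig_finite// sumEFin lee_fin fM.
Qed.

Lemma rsummable_bound f (M : R) : (forall x, 0 <= f x) ->
  (forall s : seq X, uniq s -> \sum_(x <- s) f x <= M) -> rsummable f.
Proof.
move=> f0 fM; apply: (le_lt_trans _ (ltry M)).
rewrite (@eq_esum _ _ _ _ (fun x => (f x)%:E)) ?esum_bound//.
by move=> x _; rewrite /= ger0_norm.
Qed.

Lemma rsummableD f g : rsummable f -> rsummable g -> rsummable (fun x => f x + g x).
Proof. by move=> hf hg; have := summableD hf hg. Qed.

Lemma esumZl (a : R) f : 0 <= a -> (forall x, 0 <= f x) ->
  (\esum_(x in [set: X]) (a * f x)%:E <= a%:E * \esum_(x in [set: X]) (f x)%:E)%E.
Proof.
move=> a0 f0; apply: ge_ereal_sup => _ [F [finF _] <-].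
rewrite (eq_fsbigr (fun x => a%:E * (f x)%:E)%E); last by move=> x _; rewrite EFinM.
rewrite -ge0_mule_fsumr; last by move=> x; rewrite lee_fin.
apply: lee_pmul => //; first by apply: fsume_ge0 => x _; rewrite lee_fin.
by apply: esum_ge; exists F.
Qed.

Lemma rsummableZ a f : rsummable f -> rsummable (fun x => a * f x).
Proof.
rewrite /rsummable /summable => sf.
rewrite (@eq_esum _ _ _ _ (fun x => (`|a| * `|f x|)%:E)); last first.
  by move=> x _; rewrite abse_EFin normrM.
apply: (le_lt_trans (esumZl _ _)) => //.
rewrite lte_mul_pinfty ?lee_fin//.
Qed.

Lemma rsummableN f : rsummable f -> rsummable (fun x => - f x).
Proof.
by move=> /(rsummableZ (-1)); congr rsummable; apply/funext => x; rewrite mulN1r.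
Qed.

Lemma rsum_ge0E f : (forall x, 0 <= f x) ->
  rsum f = fine (\esum_(x in [set: X]) (f x)%:E).
Proof.
move=> f0; rewrite /rsum [X in _ - fine X]esum1 ?subr0.
  by congr fine; apply: eq_esum => x _; rewrite funeposE /= max_l ?lee_fin.
by move=> x _; rewrite funenegE /= max_r// lee_fin oppr_le0.
Qed.

Lemma rsum_ge_seq f (s : seq X) : (forall x, 0 <= f x) -> rsummable f ->
  uniq s -> \sum_(x <- s) f x <= rsum f.
Proof.
move=> f0 sf us; rewrite rsum_ge0E// -lee_fin fineK ?esum_fin//.
apply: esum_ge; exists [set` s]; first by split=> //; exact: finite_seq.
by rewrite -fsbig_seq// sumEFin.
Qed.

Lemma rsum_le_bound f (M : R) : (forall x, 0 <= f x) -> 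
  (forall s : seq X, uniq s -> \sum_(x <- s) f x <= M) -> rsum f <= M.
Proof.
move=> f0 fM; rewrite rsum_ge0E// -lee_fin fineK ?esum_bound//.
by apply: esum_fin => //; apply: rsummable_bound fM.
Qed.

Lemma rsum_approx f (e : R) : (forall x, 0 <= f x) -> rsummable f -> 0 < e ->
  exists2 s : seq X, uniq s & rsum f - e <= \sum_(x <- s) f x.
Proof.
move=> f0 sf e0; apply: contrapT => nex.
have : rsum f <= rsum f - e.
  apply: rsum_le_bound => // s us; rewrite leNgt; apply/negP => h.
  by apply: nex; exists s => //; exact: ltW.
by rewrite lerBrDr gerDl leNgt e0.
Qed.

Lemma rsum_split f g h : (forall x, 0 <= g x) -> (forall x, 0 <= h x) ->
  rsummable g -> rsummable h -> (forall x, f x = g x - h x) ->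
  rsum f = rsum g - rsum h.
Proof.
move=> g0 h0 sg sh fgh; rewrite !(rsum_ge0E g0, rsum_ge0E h0).
have := @esumB R X setT (EFin \o g) (EFin \o h) sg sh.
move=> /(_ (fun x _ => g0 x) (fun x _ => h0 x)).
rewrite -[X in _ = X](@fineK _ (_ - _)%E); last first.
  by rewrite fin_numB !esum_fin.
have -> : ((EFin \o g) \- (EFin \o h))%E = (EFin \o f).
  by apply/funext => x /=; rewrite fgh EFinB.
have sf : rsummable f.
  have := rsummableD sg (rsummableN sh); congr rsummable.
  by apply/funext => x; rewrite fgh.
have h1 : esum [set: X] ((EFin \o f)^\+)%E \is a fin_num.
  have := summable_funepos sf; rewrite summableE; congr (_ \is a fin_num).
  by apply: eq_esum => x _; rewrite gee0_abs.
have h2 : esum [set: X] ((EFin \o f)^\-)%E \is a fin_num.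
  have := summable_funeneg sf; rewrite summableE; congr (_ \is a fin_num).
  by apply: eq_esum => x _; rewrite gee0_abs.
by rewrite -(fineK h1) -(fineK h2) !fineB ?esum_fin// -EFinB => -[].
Qed.

Lemma rsum_ge0 f : (forall x, 0 <= f x) -> 0 <= rsum f.
Proof.
by move=> f0; rewrite rsum_ge0E// fine_ge0// esum_ge0// => x _; rewrite lee_fin.
Qed.

Lemma rsum_ge0D f g : (forall x, 0 <= f x) -> (forall x, 0 <= g x) ->
  rsummable f -> rsummable g -> rsum (fun x => f x + g x) = rsum f + rsum g.
Proof.
move=> f0 g0 sf sg; rewrite !rsum_ge0E//; last by move=> x; rewrite addr_ge0.
rewrite -fineD ?esum_fin// -esumD//; by move=> x _; rewrite lee_fin.
Qed.

Lemma rsummable_pos f : rsummable f -> rsummable (fun x => Num.max (f x) 0).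
Proof.
move=> sf; have : rsummable (fun x => `|f x|).
  by move: sf; rewrite /rsummable /summable; congr (_ < _)%E; apply: eq_esum => x _ /=; rewrite normr_id.
by apply: rsummable_le => x; rewrite ger0_norm ?le_max ?lexx ?orbT// ge_max ler_norm/=.
Qed.

Lemma rsum_posneg f : rsummable f ->
  rsum f = rsum (fun x => Num.max (f x) 0) - rsum (fun x => Num.max (- f x) 0).
Proof.
move=> sf; apply: rsum_split => [x|x|||x].
- by rewrite le_max lexx orbT.
- by rewrite le_max lexx orbT.
- exact: rsummable_pos.
- exact/rsummable_pos/rsummableN.
- by rewrite /Num.max; case: ifPn; case: ifPn; lra.
Qed.

Lemma rsumD f g : rsummable f -> rsummable g ->
  rsum (fun x => f x + g x) = rsum f + rsum g.
Proof.
move=> sf sg; rewrite (rsum_posneg sf) (rsum_posneg sg).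
have [pf nf] := (rsummable_pos sf, rsummable_pos (rsummableN sf)).
have [pg ng] := (rsummable_pos sg, rsummable_pos (rsummableN sg)).
have m0 h x : 0 <= Num.max (h x) 0 by rewrite le_max lexx orbT.
rewrite addrACA -opprD -!rsum_ge0D//=; try by move=> x; rewrite le_max lexx orbT.
apply: rsum_split => [x|x|||x].
- by rewrite addr_ge0.
- by rewrite addr_ge0 ?le_max ?lexx ?orbT.
- exact: rsummableD.
- exact: rsummableD.
- by rewrite /Num.max; do 4!case: ifPn; lra.
Qed.

Lemma rsumN f : rsummable f -> rsum (fun x => - f x) = - rsum f.
Proof.
move=> sf; apply/eqP; rewrite -subr_eq0 opprK -rsumD//; last exact: rsummableN.
by rewrite rsum_ge0E ?esum1// => x; rewrite ?addNr.
Qed.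

Lemma le_rsum f g : rsummable f -> rsummable g -> (forall x, f x <= g x) ->
  rsum f <= rsum g.
Proof.
move=> sf sg fg; rewrite -subr_ge0 -rsumN// -rsumD//; last exact: rsummableN.
by apply: rsum_ge0 => x; rewrite subr_ge0.
Qed.

Lemma rsum_ge0Z a f : 0 <= a -> (forall x, 0 <= f x) -> rsummable f ->
  rsum (fun x => a * f x) = a * rsum f.
Proof.
move=> a0 f0 sf; apply/eqP; rewrite eq_le; apply/andP; split.
  apply: rsum_le_bound => [x|s us]; first by rewrite mulr_ge0.
  by rewrite -mulr_sumr ler_wpM2l// rsum_ge_seq.
have [->|an0] := eqVneq a 0.
  by rewrite mul0r rsum_ge0// => x; rewrite mul0r.
have {an0} a1 : 0 < a by rewrite lt_neqAle eq_sym an0.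
rewrite mulrC -ler_pdivlMr//; apply: rsum_le_bound => // s us.
rewrite ler_pdivlMr// mulrC mulr_sumr rsum_ge_seq//.
- by move=> x; rewrite mulr_ge0.
- exact: rsummableZ.
Qed.

Lemma rsumZ a f : rsummable f -> rsum (fun x => a * f x) = a * rsum f.
Proof.
have pos b : 0 <= b -> rsummable f -> rsum (fun x => b * f x) = b * rsum f.
  move=> b0 sf; rewrite [in RHS]rsum_posneg// mulrBr.
  have [pf nf] := (rsummable_pos sf, rsummable_pos (rsummableN sf)).
  have m0 h x : 0 <= Num.max (h x) 0 by rewrite le_max lexx orbT.
  rewrite -!rsum_ge0Z//; try by move=> x; rewrite le_max lexx orbT.
  apply: rsum_split => [x|x|||x].
  - by rewrite mulr_ge0.
  - by rewrite mulr_ge0// le_max lexx orbT.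
  - exact: rsummableZ.
  - exact: rsummableZ.
  - by rewrite -mulrBr; congr (_ * _); rewrite /Num.max; do 2!case: ifPn; lra.
move=> sf; have [a0|a0] := leP 0 a; first exact: pos.
rewrite -[LHS]opprK -rsumN; last exact: rsummableZ.
rewrite (_ : (fun x => - (a * f x)) = (fun x => (- a) * f x)).
  by rewrite pos ?oppr_ge0 ?ltW// mulNr opprK.
by apply/funext => x; rewrite mulNr.
Qed.

Lemma rsum_eq0 f : (forall x, 0 <= f x) -> rsummable f -> rsum f = 0 ->
  forall x, f x = 0.
Proof.
move=> f0 sf h x; apply/eqP; rewrite eq_le f0 andbT.
by have := @rsum_ge_seq f [:: x] f0 sf isT; rewrite h big_seq1.
Qed.

Lemma sum_subseq f (s s' : seq X) : (forall x, 0 <= f x) ->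
  uniq s -> uniq s' -> (forall x, x \notin s -> f x = 0) ->
  \sum_(x <- s') f x <= \sum_(x <- s) f x.
Proof.
move=> f0 us us' fs.
rewrite (bigID (mem s))/= [X in _ + X]big1 ?addr0; last by move=> x /fs.
rewrite -big_filter (perm_big [seq x <- s | x \in s']) /=; last first.
  apply: uniq_perm; rewrite ?filter_uniq// => x.
  by rewrite !mem_filter andbC.
rewrite big_filter big_mkcond/=; apply: ler_sum => x _.
by case: ifP.
Qed.

Lemma rsum_fin f (s : seq X) : uniq s -> (forall x, x \notin s -> f x = 0) ->
  rsummable f /\ rsum f = \sum_(x <- s) f x.
Proof.
move=> us fs.
have nn h : (forall x, 0 <= h x) -> (forall x, x \notin s -> h x = 0) ->
    rsummable h /\ rsum h = \sum_(x <- s) h x.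
  move=> h0 hs.
  have b s' : uniq s' -> \sum_(x <- s') h x <= \sum_(x <- s) h x.
    by move=> us'; apply: sum_subseq.
  have sh : rsummable h by exact: rsummable_bound b.
  split=> //; apply/eqP; rewrite eq_le rsum_le_bound//=.
  exact: rsum_ge_seq.
have m0 (h : X -> R) x : 0 <= Num.max (h x) 0 by rewrite le_max lexx orbT.
have [||sp ep] := nn (fun x => Num.max (f x) 0).
- by move=> x; exact: m0.
- by move=> x /fs ->; rewrite maxxx.
have [||sn en] := nn (fun x => Num.max (- f x) 0).
- by move=> x; rewrite le_max lexx orbT.
- by move=> x /fs ->; rewrite oppr0 maxxx.
have e x : f x = Num.max (f x) 0 - Num.max (- f x) 0.
  by rewrite /Num.max; case: ifPn; case: ifPn; lra.
split.
  rewrite (_ : f = (fun x => Num.max (f x) 0 - Num.max (- f x) 0)); last exact/funext.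
  by apply: rsummableD => //; exact: rsummableN.
rewrite (rsum_split _ _ sp sn e).
- by rewrite ep en -sumrB; apply: eq_bigr => x _; rewrite -e.
- by move=> x; exact: m0.
- by move=> x; rewrite le_max lexx orbT.
Qed.

End real_sums.

Section complex_sums.
Context {R : realType} {X : choiceType}.
Implicit Types (f g h : X -> R[i]).

Definition csummable f := rsummable (fun x => normc (f x)).

Definition csum f : R[i] :=
  Complex (rsum (fun x => complex.Re (f x))) (rsum (fun x => complex.Im (f x))).

Lemma addcE (a b c d : R) :
  Complex a b + Complex c d = Complex (a + c) (b + d).
Proof. by []. Qed.

Lemma mulcE (a b c d : R) :
  Complex a b * Complex c d = Complex (a * c - b * d) (a * d + b * c).
Proof. by []. Qed.

Lemma normc_sqr (z : R[i]) :
  normc z ^+ 2 = complex.Re z ^+ 2 + complex.Im z ^+ 2.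
Proof. by case: z => a b /=; rewrite sqr_sqrtr// addr_ge0 ?sqr_ge0. Qed.

Lemma normc_ge0 (z : R[i]) : 0 <= normc z.
Proof. by case: z => a b; exact: sqrtr_ge0. Qed.

Lemma normc_Re (z : R[i]) : `|complex.Re z| <= normc z.
Proof.
rewrite -(@ler_pXn2r _ 2)// ?nnegrE ?normc_ge0// normc_sqr.
by rewrite -normrX ger0_norm ?sqr_ge0// lerDl sqr_ge0.
Qed.

Lemma normc_Im (z : R[i]) : `|complex.Im z| <= normc z.
Proof.
rewrite -(@ler_pXn2r _ 2)// ?nnegrE ?normc_ge0// normc_sqr.
by rewrite -normrX ger0_norm ?sqr_ge0// lerDr sqr_ge0.
Qed.

Lemma csummableRe f : csummable f -> rsummable (fun x => complex.Re (f x)).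
Proof. by apply: rsummable_le => x; exact: normc_Re. Qed.

Lemma csummableIm f : csummable f -> rsummable (fun x => complex.Im (f x)).
Proof. by apply: rsummable_le => x; exact: normc_Im. Qed.

Lemma csummable_le f (g : X -> R) : (forall x, normc (f x) <= g x) ->
  rsummable g -> csummable f.
Proof.
by move=> fg; apply: rsummable_le => x; rewrite ger0_norm ?normc_ge0.
Qed.

Lemma csumD f g : csummable f -> csummable g ->
  csum (fun x => f x + g x) = csum f + csum g.
Proof.
move=> sf sg; rewrite /csum.
have [rf imf] := (csummableRe sf, csummableIm sf).
have [rg img] := (csummableRe sg, csummableIm sg).
rewrite addcE -!rsumD//.
by congr Complex; congr rsum; apply/funext => x; case: (f x) (g x) => ? ? [].
Qed.

Lemma csummableZ a f : csummable f -> csummable (fun x => a * f x).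
Proof.
move=> sf; apply: csummable_le (rsummableZ (normc a) sf) => x.
by rewrite normcM.
Qed.

Lemma csumZ a f : csummable f -> csum (fun x => a * f x) = a * csum f.
Proof.
move=> sf; have [rf imf] := (csummableRe sf, csummableIm sf).
case: a => a b; rewrite /csum mulcE.
rewrite -(rsumZ a rf) -(rsumZ b imf) -(rsumZ a imf) -(rsumZ b rf).
rewrite -rsumN; last exact: rsummableZ.
rewrite -rsumD; [|exact: rsummableZ|exact/rsummableN/rsummableZ].
rewrite -rsumD; [|exact: rsummableZ|exact/rsummableZ].
by congr Complex; congr rsum; apply/funext => x; case: (f x).
Qed.

Lemma csum_conj f : csummable f -> csum (fun x => conjc (f x)) = conjc (csum f).
Proof.
move=> sf; have imf := csummableIm sf.
rewrite /csum /= -rsumN//.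
by congr Complex; congr rsum; apply/funext => x; case: (f x).
Qed.

Lemma csum_fin f (s : seq X) : uniq s -> (forall x, x \notin s -> f x = 0) ->
  csum f = \sum_(x <- s) f x.
Proof.
move=> us fs; rewrite /csum.
have [x /fs ->//|_ ->] := @rsum_fin R X (fun x => complex.Re (f x)) s us.
have [x /fs ->//|_ ->] := @rsum_fin R X (fun x => complex.Im (f x)) s us.
elim: {us fs} s => [|x s IH]; first by rewrite !big_nil.
by rewrite !big_cons -IH; case: (f x).
Qed.

End complex_sums.

Section l2_space.
Context (R : realType) (X : choiceType).

Definition square_summable : set (X -> R[i]) :=
  [set f | rsummable (fun x => normc (f x) ^+ 2)].

Definition l2_pred : {pred X -> R[i]} := mem square_summable.

Record l2 := L2 { l2_fun :> X -> R[i] ; _ : l2_fun \in l2_pred }.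

HB.instance Definition _ := [isSub for l2_fun].
HB.instance Definition _ := [Choice of l2 by <:].

Lemma square_summable_submod : submod_closed l2_pred.
Proof.
split.
  rewrite inE /square_summable/=.
  rewrite (_ : (fun _ => _) = (fun=> 0)); first by case: (@rsum_fin R X (fun=> 0) [::]).
  by apply/funext => x; rewrite expr0n addr0 sqrtr0 expr0n.
move=> a f g; rewrite !inE /square_summable/= => sf sg.
apply: rsummable_le (rsummableD (rsummableZ (2 * normc a ^+ 2) sf) (rsummableZ 2 sg)).
move=> x; rewrite ger0_norm ?sqr_ge0// normc_sqr.
rewrite -mulrA -exprMn -normcM !normc_sqr.
change ((a *: f + g) x) with (a * f x + g x).
case: (a * f x) (g x) => p q [r s]; rewrite addcE/=.
have := sqr_ge0 (p - r); have := sqr_ge0 (q - s); rewrite !sqrrB !sqrrD; lra.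
Qed.

HB.instance Definition _ :=
  GRing.isSubmodClosed.Build R[i] (X -> R[i]) l2_pred square_summable_submod.
HB.instance Definition _ := [SubChoice_isSubLmodule of l2 by <:].

End l2_space.

Section l2_inner_product.
Context {R : realType} {X : choiceType}.
Implicit Types (f g h : l2 R X) (a : R[i]) (x y : X).

(* Linear in the first variable, conjugate-linear in the second. *)
Definition dot f g : R[i] := csum (fun x => f x * conjc (g x)).

Definition l2norm f : R := Num.sqrt (rsum (fun x => normc (f x) ^+ 2)).

Lemma l2_ext f g : (forall x, f x = g x) -> f = g.
Proof. by move=> fg; apply/val_inj/funext. Qed.

Lemma l2_summable f : rsummable (fun x => normc (f x) ^+ 2).
Proof. by case: f => f /=; rewrite inE. Qed.

Lemma l2DE f g x : (f + g) x = f x + g x. Proof. by []. Qed.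
Lemma l2ZE a f x : (a *: f) x = a * f x. Proof. by []. Qed.
Lemma l2NE f x : (- f) x = - f x. Proof. by []. Qed.
Lemma l20E x : (0 : l2 R X) x = 0. Proof. by []. Qed.
Lemma l2_sumE (I : Type) (s : seq I) (F : I -> l2 R X) x :
  (\sum_(i <- s) F i) x = \sum_(i <- s) F i x.
Proof.
elim: s => [|i s IH]; first by rewrite !big_nil.
by rewrite !big_cons l2DE IH.
Qed.

Lemma normc_conjc (z : R[i]) : normc (conjc z) = normc z.
Proof. by case: z => a b /=; rewrite sqrrN. Qed.

Lemma dot_summable f g : csummable (fun x => f x * conjc (g x)).
Proof.
apply: csummable_le (rsummableD (l2_summable f) (l2_summable g)) => x.
rewrite normcM normc_conjc.
have := sqr_ge0 (normc (f x) - normc (g x)).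
have := normc_ge0 (f x); have := normc_ge0 (g x); nra.
Qed.

Lemma dotDl f g h : dot (f + g) h = dot f h + dot g h.
Proof.
rewrite /dot -csumD; try exact: dot_summable.
by congr csum; apply/funext => x; rewrite l2DE mulrDl.
Qed.

Lemma dotZl a f g : dot (a *: f) g = a * dot f g.
Proof.
rewrite /dot -csumZ; last exact: dot_summable.
by congr csum; apply/funext => x; rewrite l2ZE mulrA.
Qed.

Lemma dotC f g : dot g f = conjc (dot f g).
Proof.
rewrite /dot -csum_conj; last exact: dot_summable.
by congr csum; apply/funext => x; rewrite rmorphM/= conjcK mulrC.
Qed.

Lemma dotDr f g h : dot f (g + h) = dot f g + dot f h.
Proof. by rewrite dotC dotDl rmorphD (dotC g f) (dotC h f). Qed.

Lemma dotZr a f g : dot f (a *: g) = conjc a * dot f g.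
Proof. by rewrite dotC dotZl rmorphM (dotC g f). Qed.

Lemma l2norm_ge0 f : 0 <= l2norm f. Proof. exact: sqrtr_ge0. Qed.

Lemma sqr_l2norm f : l2norm f ^+ 2 = rsum (fun x => normc (f x) ^+ 2).
Proof. by rewrite sqr_sqrtr// rsum_ge0// => x; rewrite sqr_ge0. Qed.

Lemma dotE f : dot f f = Complex (l2norm f ^+ 2) 0.
Proof.
rewrite sqr_l2norm /dot /csum; congr Complex.
  congr rsum; apply/funext => x; rewrite normc_sqr.
  by case: (f x) => a b /=; ring.
rewrite (_ : (fun x => _) = (fun=> 0)).
  by rewrite rsum_ge0E ?esum1.
by apply/funext => x; case: (f x) => a b /=; ring.
Qed.

Lemma l2norm_eq0 f : l2norm f = 0 -> f = 0.
Proof.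
move=> f0; apply: l2_ext => x; apply: eq0_normc; apply/eqP.
rewrite -sqrf_eq0; apply/eqP; apply: rsum_eq0 (l2_summable f) _ x.
  by move=> x; rewrite sqr_ge0.
by rewrite -sqr_l2norm f0 expr0n.
Qed.

Lemma l2norm0 : l2norm 0 = 0.
Proof.
apply/eqP; rewrite -sqrf_eq0 sqr_l2norm.
rewrite (_ : (fun x => _) = (fun=> 0)); first by rewrite rsum_ge0E ?esum1.
by apply/funext => x; rewrite l20E normc0 expr0n.
Qed.

Lemma l2normZ a f : l2norm (a *: f) = normc a * l2norm f.
Proof.
apply/eqP; rewrite -(@eqrXn2 _ 2)// ?mulr_ge0 ?l2norm_ge0 ?normc_ge0//.
rewrite exprMn !sqr_l2norm -rsumZ; last exact: l2_summable.
by apply/eqP; congr rsum; apply/funext => x; rewrite l2ZE normcM exprMn.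
Qed.

Lemma sqr_l2normD f g :
  l2norm (f + g) ^+ 2 = l2norm f ^+ 2 + l2norm g ^+ 2 + 2 * complex.Re (dot f g).
Proof.
have /(congr1 (@complex.Re R)) := dotE (f + g).
rewrite dotDl !dotDr [dot g f]dotC !dotE.
by case: (dot f g) => a b; rewrite !addcE/=; lra.
Qed.

Lemma cauchy_schwarz f g : normc (dot f g) <= l2norm f * l2norm g.
Proof.
have [g0|gn0] := eqVneq (l2norm g) 0.
  rewrite (l2norm_eq0 g0) l2norm0 mulr0 dotC -(scale0r 0) dotZl mul0r.
  by rewrite conjc0 normc0.
have gp : 0 < l2norm g ^+ 2 by rewrite exprn_gt0// lt_neqAle eq_sym gn0 l2norm_ge0.
rewrite -(@ler_pXn2r _ 2)// ?nnegrE ?mulr_ge0 ?l2norm_ge0 ?normc_ge0// exprMn.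
have := sqr_ge0 (l2norm (Complex (l2norm g ^+ 2) 0 *: f + (- dot f g) *: g)).
rewrite sqr_l2normD !l2normZ dotZl dotZr.
have -> : normc (- dot f g) = normc (dot f g).
  by case: (dot f g) => a b /=; rewrite !sqrrN.
have -> : normc (Complex (l2norm g ^+ 2) 0) = l2norm g ^+ 2.
  by rewrite /= expr0n addr0 sqrtr_sqr ger0_norm ?sqr_ge0.
rewrite !exprMn.
have -> : complex.Re (Complex (l2norm g ^+ 2) 0 * (conjc (- dot f g) * dot f g))
   = - (l2norm g ^+ 2 * normc (dot f g) ^+ 2).
  rewrite normc_sqr; case: (dot f g) => a b /=; ring.
set F := l2norm f ^+ 2; set D := normc _ ^+ 2; move: gp; set G := l2norm g ^+ 2.
move=> gp h; have : 0 <= G * (F * G - D) by nra.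
by rewrite pmulr_rge0// subr_ge0.
Qed.

Lemma l2normD f g : l2norm (f + g) <= l2norm f + l2norm g.
Proof.
rewrite -(@ler_pXn2r _ 2)// ?nnegrE ?addr_ge0 ?l2norm_ge0//.
rewrite sqr_l2normD.
have := cauchy_schwarz f g; have := normc_Re (dot f g); rewrite ler_norml => /andP[_].
nra.
Qed.

Lemma delta_subproof y : (fun x : X => (x == y)%:R : R[i]) \in @l2_pred R X.
Proof.
rewrite inE /square_summable/=.
have [] // := @rsum_fin R X (fun x => normc ((x == y)%:R : R[i]) ^+ 2) [:: y].
by move=> x; rewrite inE => /negbTE ->; rewrite normc0 expr0n.
Qed.
Definition delta y : l2 R X := L2 (delta_subproof y).

Lemma deltaE x y : delta y x = (x == y)%:R. Proof. by []. Qed.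

Lemma dot_delta f x : dot f (delta x) = f x.
Proof.
rewrite /dot (@csum_fin _ _ _ [:: x])// ?big_seq1 ?deltaE ?eqxx ?conjc1 ?mulr1//.
by move=> y; rewrite inE deltaE => /negbTE ->; rewrite conjc0 mulr0.
Qed.

Definition trunc f (s : seq X) : l2 R X := \sum_(x <- s) f x *: delta x.

Lemma truncE f s x : uniq s -> trunc f s x = if x \in s then f x else 0.
Proof.
move=> us; rewrite l2_sumE.
under eq_bigr do rewrite l2ZE deltaE.
case: ifPn => xs.
  rewrite (bigD1_seq x)//= eqxx mulr1 big1 ?addr0// => y.
  by rewrite eq_sym => /negbTE ->; rewrite mulr0.
rewrite big_seq big1// => y ys.
by case: eqP => [e|_]; [rewrite e ys in xs|rewrite mulr0].
Qed.

Lemma trunc_approx f (e : R) : 0 < e ->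
  exists s, l2norm (f - trunc f s) <= e.
Proof.
move=> e0; have e2 : 0 < e ^+ 2 by rewrite exprn_gt0.
have [|s us hs] := @rsum_approx R X _ (e ^+ 2) _ (l2_summable f) e2.
  by move=> x; rewrite sqr_ge0.
exists s; rewrite -(@ler_pXn2r _ 2)// ?nnegrE ?l2norm_ge0 ?(ltW e0)//.
rewrite -sqr_l2norm in hs.
have : l2norm f ^+ 2 = l2norm (f - trunc f s) ^+ 2 + l2norm (trunc f s) ^+ 2.
  rewrite !sqr_l2norm -rsumD; try exact: l2_summable.
  congr rsum; apply/funext => x; rewrite l2DE l2NE truncE//.
  by case: ifP; rewrite ?subrr ?subr0 normc0 expr0n/= ?add0r ?addr0.
have -> : l2norm (trunc f s) ^+ 2 = \sum_(x <- s) normc (f x) ^+ 2.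
  rewrite sqr_l2norm.
  have [|_ ->] := @rsum_fin R X (fun x => normc (trunc f s x) ^+ 2) s us.
    by move=> x xs; rewrite truncE// (negbTE xs) normc0 expr0n.
  by apply: eq_big_seq => x xs; rewrite truncE// xs.
by move=> fe; lra.
Qed.

End l2_inner_product.

Section l2_normed.
Context (R : realType) (X : choiceType).

(* A normed module over R[i] has an R[i]-valued norm. *)
Definition l2_cnorm (f : l2 R X) : R[i] := Complex (l2norm f) 0.

Lemma l2_cnormD f g : l2_cnorm (f + g) <= l2_cnorm f + l2_cnorm g.
Proof. by rewrite /l2_cnorm addcE addr0 lecE/= eqxx l2normD. Qed.

Lemma l2_cnormZ (a : R[i]) f : l2_cnorm (a *: f) = `|a| * l2_cnorm f.
Proof.
rewrite /l2_cnorm l2normZ normc_def.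
by case: a => a b; rewrite /= mulcE/= !(mulr0, mul0r) subr0 addr0.
Qed.

Lemma l2_cnorm_eq0 f : l2_cnorm f = 0 -> f = 0.
Proof. by move=> /(congr1 (@complex.Re R)) /= /l2norm_eq0. Qed.

HB.instance Definition _ :=
  Lmodule_isNormed.Build R[i] (l2 R X) l2_cnormD l2_cnormZ l2_cnorm_eq0.

Lemma l2_normE (f : l2 R X) : `|f| = Complex (l2norm f) 0. Proof. by []. Qed.

End l2_normed.

Section bounded_operators.
Context (R : realType) (X : choiceType).
Local Notation H := (l2 R X).

Definition bounded_linear : set (H -> H) :=
  [set T | linear T /\ exists M : R, forall f, l2norm (T f) <= M * l2norm f].

Definition bop_pred : {pred H -> H} := mem bounded_linear.

Record bop := Bop { bop_fun :> H -> H ; _ : bop_fun \in bop_pred }.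

HB.instance Definition _ := [isSub for bop_fun].
HB.instance Definition _ := [Choice of bop by <:].

Lemma bounded_linear_submod : submod_closed bop_pred.
Proof.
split; first rewrite inE; last (move=> a S T; rewrite !inE => -[lS [M SM]] [lT [N TN]]).
  split; first by move=> a u v; rewrite scaler0 addr0.
  by exists 0 => f; rewrite mul0r l2norm0.
split=> [b u v|].
  change (a *: S (b *: u + v) + T (b *: u + v) =
          b *: (a *: S u + T u) + (a *: S v + T v)).
  by rewrite lS lT !scalerDr addrACA !scalerA (mulrC a b).
exists (normc a * M + N) => f.
change (l2norm (a *: S f + T f) <= (normc a * M + N) * l2norm f).
rewrite (le_trans (l2normD _ _))// l2normZ mulrDl lerD// -mulrA.
by rewrite ler_wpM2l// normc_ge0.
Qed.

HB.instance Definition _ :=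
  GRing.isSubmodClosed.Build R[i] (H -> H) bop_pred bounded_linear_submod.
HB.instance Definition _ := [SubChoice_isSubLmodule of bop by <:].

Implicit Types (S T : bop) (f g : H).

Lemma bop_ext S T : (forall f, S f = T f) -> S = T.
Proof. by move=> ST; apply/val_inj/funext. Qed.

Lemma bopP T : bounded_linear T.
Proof. by case: T => T /=; rewrite inE. Qed.

Lemma bop_linear T : linear T. Proof. by case: (bopP T). Qed.

HB.instance Definition _ T :=
  GRing.isLinear.Build R[i] H H *:%R T (@bop_linear T).

Lemma bopDE S T f : (S + T) f = S f + T f. Proof. by []. Qed.
Lemma bopZE (a : R[i]) T f : (a *: T) f = a *: T f. Proof. by []. Qed.
Lemma bopNE T f : (- T) f = - T f. Proof. by []. Qed.
Lemma bop0E f : (0 : bop) f = 0. Proof. by []. Qed.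

Lemma bop1_subproof : idfun \in bop_pred.
Proof. by rewrite inE; split=> //; exists 1 => f; rewrite mul1r. Qed.

Lemma bop_comp_subproof S T : S \o T \in bop_pred.
Proof.
rewrite inE; split=> [a u v|]; first by rewrite /= !linearP.
have [[_ [M SM]] [_ [N TN]]] := (bopP S, bopP T).
exists (`|M| * N) => f /=; rewrite (le_trans (SM _))// -mulrA.
rewrite (le_trans (ler_wpM2r (l2norm_ge0 _) (ler_norm M)))//.
by rewrite ler_wpM2l.
Qed.

Definition bop_one : bop := Bop bop1_subproof.
Definition bop_comp S T : bop := Bop (bop_comp_subproof S T).

Fact bop_compA : associative bop_comp. Proof. by move=> *; exact: bop_ext. Qed.
Fact bop_comp1l : left_id bop_one bop_comp. Proof. by move=> *; exact: bop_ext. Qed.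
Fact bop_comp1r : right_id bop_one bop_comp. Proof. by move=> *; exact: bop_ext. Qed.
Fact bop_compDl : left_distributive bop_comp +%R.
Proof. by move=> *; exact: bop_ext. Qed.
Fact bop_compDr : right_distributive bop_comp +%R.
Proof. by move=> S T U; apply: bop_ext => f; exact: linearD. Qed.

HB.instance Definition _ := GRing.Zmodule_isPzRing.Build bop
  bop_compA bop_comp1l bop_comp1r bop_compDl bop_compDr.

Lemma bopME S T f : (S * T) f = S (T f). Proof. by []. Qed.
Lemma bop1E f : (1 : bop) f = f. Proof. by []. Qed.

Definition opnorm T : R := sup [set l2norm (T f) | f in [set f | l2norm f <= 1]].

Lemma opnorm_has_sup T : has_sup [set l2norm (T f) | f in [set f | l2norm f <= 1]].
Proof.
split; first by exists (l2norm (T 0)), 0 => //=; rewrite l2norm0.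
have [_ [M TM]] := bopP T; exists `|M| => _ [f /= f1 <-].
rewrite (le_trans (TM _))// (le_trans (ler_wpM2r (l2norm_ge0 _) (ler_norm M)))//.
by rewrite ler_piMr.
Qed.

Lemma opnorm_ge0 T : 0 <= opnorm T.
Proof.
apply: (le_trans (l2norm_ge0 (T 0))).
apply: (sup_upper_bound (opnorm_has_sup T)).
by exists 0 => //=; rewrite l2norm0.
Qed.

Lemma opnormP T f : l2norm (T f) <= opnorm T * l2norm f.
Proof.
have [f0|f0] := eqVneq (l2norm f) 0.
  by rewrite (l2norm_eq0 f0) linear0 l2norm0 mulr0.
have fp : 0 < l2norm f by rewrite lt_neqAle eq_sym f0 l2norm_ge0.
pose a : R[i] := Complex (l2norm f)^-1 0.
have na : normc a = (l2norm f)^-1.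
  by rewrite /= expr0n addr0 sqrtr_sqr ger0_norm// invr_ge0 l2norm_ge0.
have : l2norm (T (a *: f)) <= opnorm T.
  apply: (sup_upper_bound (opnorm_has_sup T)); exists (a *: f) => //=.
  by rewrite l2normZ na mulVf.
by rewrite linearZ l2normZ na mulrC ler_pdivrMr.
Qed.

Lemma opnorm_le T (M : R) : 0 <= M ->
  (forall f, l2norm (T f) <= M * l2norm f) -> opnorm T <= M.
Proof.
move=> M0 TM; apply: ge_sup; first by case: (opnorm_has_sup T).
by move=> _ [f /= f1 <-]; rewrite (le_trans (TM _))// ler_piMr.
Qed.

Definition bop_cnorm T : R[i] := Complex (opnorm T) 0.

Lemma bop_cnormD S T : bop_cnorm (S + T) <= bop_cnorm S + bop_cnorm T.
Proof.
rewrite /bop_cnorm addcE addr0 lecE/= eqxx/=.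
apply: opnorm_le => [|f]; first by rewrite addr_ge0// opnorm_ge0.
by rewrite bopDE (le_trans (l2normD _ _))// mulrDl lerD ?opnormP.
Qed.

Lemma opnormZ (a : R[i]) T : opnorm (a *: T) = normc a * opnorm T.
Proof.
have le b U : opnorm (b *: U) <= normc b * opnorm U.
  apply: opnorm_le => [|f]; first by rewrite mulr_ge0 ?normc_ge0 ?opnorm_ge0.
  by rewrite bopZE l2normZ -mulrA ler_wpM2l ?normc_ge0 ?opnormP.
apply/eqP; rewrite eq_le le/=.
have [->|a0] := eqVneq a 0; first by rewrite normc0 mul0r opnorm_ge0.
have na : 0 < normc a.
  rewrite lt_neqAle normc_ge0 andbT eq_sym.
  by apply: contra a0 => /eqP /eq0_normc ->.
rewrite mulrC -ler_pdivlMr// mulrC -normcV.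
by rewrite -[X in opnorm X <= _](scalerK a0 T) le.
Qed.

Lemma bop_cnormZ (a : R[i]) T : bop_cnorm (a *: T) = `|a| * bop_cnorm T.
Proof.
rewrite /bop_cnorm opnormZ normc_def.
by case: a => a b; rewrite /= mulcE/= !(mulr0, mul0r) subr0 addr0.
Qed.

Lemma bop_cnorm_eq0 T : bop_cnorm T = 0 -> T = 0.
Proof.
move=> /(congr1 (@complex.Re R)) /= T0; apply: bop_ext => f; apply: l2norm_eq0.
by apply/eqP; rewrite eq_le l2norm_ge0 andbT (le_trans (opnormP _ _))// T0 mul0r.
Qed.

HB.instance Definition _ :=
  Lmodule_isNormed.Build R[i] bop bop_cnormD bop_cnormZ bop_cnorm_eq0.

Lemma bop_normE T : `|T| = Complex (opnorm T) 0. Proof. by []. Qed.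

Section adjoint.
Variable T : bop.

Let adj_fun f : X -> R[i] := fun x => dot f (T (delta x)).

Let adj_sum f (s : seq X) : uniq s ->
  \sum_(x <- s) normc (adj_fun f x) ^+ 2 <= (opnorm T * l2norm f) ^+ 2.
Proof.
move=> us; pose w : H := \sum_(x <- s) adj_fun f x *: delta x.
set S := \sum_(x <- s) _.
have S0 : 0 <= S by apply: sumr_ge0 => x _; rewrite sqr_ge0.
have wS : l2norm w ^+ 2 = S.
  rewrite sqr_l2norm.
  have wE x : w x = if x \in s then adj_fun f x else 0.
    rewrite l2_sumE; under eq_bigr do rewrite l2ZE deltaE.
    case: ifPn => xs.
      rewrite (bigD1_seq x)//= eqxx mulr1 big1 ?addr0// => y.
      by rewrite eq_sym => /negbTE ->; rewrite mulr0.
    rewrite big_seq big1// => y ys.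
    by case: eqP => [e|_]; [rewrite e ys in xs|rewrite mulr0].
  have [|_ ->] := @rsum_fin R X (fun x => normc (w x) ^+ 2) s us.
    by move=> x xs; rewrite wE (negbTE xs) normc0 expr0n.
  by apply: eq_big_seq => x xs; rewrite wE xs.
have dS : dot f (T w) = Complex S 0.
  rewrite linear_sum/=.
  transitivity (\sum_(x <- s) (conjc (adj_fun f x) * adj_fun f x)).
    elim: (s) => [|x s' IH].
      by rewrite !big_nil dotC -(scale0r 0) dotZl mul0r conjc0.
    by rewrite !big_cons dotDr IH linearZ/= dotZr.
  rewrite /S; elim: (s) => [|x s' IH]; first by rewrite !big_nil.
  rewrite !big_cons IH normc_sqr; case: (adj_fun f x) => a b.
  rewrite /= mulcE addcE; congr Complex; ring.
have : S <= l2norm f * (opnorm T * l2norm w).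
  have := cauchy_schwarz f (T w); rewrite dS /= expr0n addr0 sqrtr_sqr ger0_norm//.
  move=> /le_trans; apply; rewrite ler_wpM2l ?l2norm_ge0 ?opnormP//.
move: (l2norm_ge0 w) (l2norm_ge0 f) (opnorm_ge0 T); rewrite -wS.
move: (l2norm w) (l2norm f) (opnorm T) => n m o n0 m0 o0 h.
have [->|nn] := eqVneq n 0; first by rewrite expr0n/= sqr_ge0.
have np : 0 < n by rewrite lt_neqAle eq_sym nn.
rewrite ler_pXn2r ?nnegrE ?mulr_ge0//.
by rewrite -(ler_pM2r np) -expr2 (le_trans h)// mulrA (mulrC m).
Qed.

Let adj_subproof f : adj_fun f \in @l2_pred R X.
Proof.
rewrite inE; apply: rsummable_bound (@adj_sum f) => x; exact: sqr_ge0.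
Qed.

Let adj_l2 f : H := L2 (adj_subproof f).

Let adj_bop_subproof : adj_l2 \in bop_pred.
Proof.
rewrite inE; split=> [a u v|].
  by apply: l2_ext => x; rewrite l2DE l2ZE /= /adj_fun dotDl dotZl.
exists (opnorm T) => f.
rewrite -(@ler_pXn2r _ 2)// ?nnegrE ?mulr_ge0 ?l2norm_ge0 ?opnorm_ge0//.
rewrite sqr_l2norm; apply: rsum_le_bound (@adj_sum f) => x; exact: sqr_ge0.
Qed.

Lemma adjoint_exists : exists S : bop, forall f g, dot (T f) g = dot f (S g).
Proof.
exists (Bop adj_bop_subproof) => f g; set S := Bop _.
have fin s : dot (T (trunc f s)) g = dot (trunc f s) (S g).
  rewrite /trunc linear_sum/=; elim: s => [|x s IH].
    by rewrite !big_nil -(scale0r 0) !dotZl !mul0r.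
  rewrite !big_cons !dotDl IH linearZ/= !dotZl; congr (_ * _ + _).
  by rewrite dotC [RHS]dotC dot_delta.
apply/eqP; rewrite -subr_eq0; apply/eqP/eq0_normc/eqP.
rewrite eq_le normc_ge0 andbT; apply/ler_addgt0Pl => e e0; rewrite addr0.
pose K := opnorm T * l2norm g + opnorm S * l2norm g + 1.
have K0 : 0 < K by rewrite ltr_wpDl// addr_ge0// mulr_ge0 ?opnorm_ge0 ?l2norm_ge0.
have [s hs] := @trunc_approx R X f (e / K) (divr_gt0 e0 K0).
set r := f - trunc f s in hs.
have fE : f = trunc f s + r by rewrite addrC subrK.
have -> : dot (T f) g - dot f (S g) = dot (T r) g - dot r (S g).
  by rewrite {1 2}fE linearD !dotDl fin opprD addrACA subrr add0r.
have nB (z w : R[i]) : normc (z - w) <= normc z + normc w.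
  by rewrite -(@normcN R w) (@le_normcD R).
rewrite (le_trans (nB _ _))//.
have rK : l2norm r * K <= e by rewrite -ler_pdivlMr.
apply: le_trans rK.
have h1 := cauchy_schwarz (T r) g; have h2 := cauchy_schwarz r (S g).
have h3 := ler_wpM2r (l2norm_ge0 g) (opnormP T r).
have h4 := ler_wpM2l (l2norm_ge0 r) (opnormP S g).
have h5 := l2norm_ge0 r; rewrite /K; lra.
Qed.

End adjoint.

Definition adj T : bop := projT1 (cid (adjoint_exists T)).

Lemma adjP T f g : dot (T f) g = dot f (adj T g).
Proof. by rewrite /adj; case: cid. Qed.

End bounded_operators.

Section cstar_algebras.
Context {R : realType} {X : choiceType}.
Local Notation B := (bop R X).
Implicit Types (S T U : B) (A D : set B).

(* Subalgebras are not required to be unital. *)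
Definition star_subalgebra A : Prop :=
  [/\ A 0,
      forall (a : R[i]) S T, A S -> A T -> A (a *: S + T),
      forall S T, A S -> A T -> A (S * T) &
      forall T, A T -> A (adj T)].

(* The topology on bop is that of the operator norm, see bop_cnorm. *)
Definition cstar_subalgebra A : Prop := star_subalgebra A /\ closed A.

(* Meaningful when A is a C*-algebra containing D, as otherwise the family may
   be empty; for ptrans_algebra see uniform_roe_cstar and pb_op_uniform_roe. *)
Definition cstar_generated A D : set B :=
  \bigcap_(E in [set E | [/\ cstar_subalgebra E, E `<=` A & D `<=` E]]) E.

Definition unitary U : Prop := U * adj U = 1 /\ adj U * U = 1.

Definition star_isomorphism A D (phi : B -> B) : Prop :=
  [/\ set_bij A D phi,
      forall (a : R[i]) S T, A S -> A T -> phi (a *: S + T) = a *: phi S + phi T,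
      forall S T, A S -> A T -> phi (S * T) = phi S * phi T &
      forall T, A T -> phi (adj T) = adj (phi T)].

Lemma dot_inj (f g : l2 R X) : (forall h, dot h f = dot h g) -> f = g.
Proof.
move=> fg; apply: l2_ext => x; rewrite -dot_delta -[RHS]dot_delta.
by rewrite dotC fg -dotC.
Qed.

Lemma adj_unique T S : (forall f g, dot (T f) g = dot f (S g)) -> adj T = S.
Proof. by move=> TS; apply: bop_ext => g; apply: dot_inj => f; rewrite -adjP TS. Qed.

Lemma adjK T : adj (adj T) = T.
Proof. by apply: adj_unique => f g; rewrite dotC -adjP -dotC. Qed.

Lemma adj0 : adj (0 : B) = 0.
Proof.
apply: adj_unique => f g; rewrite !bop0E [RHS]dotC.
by rewrite -(scale0r 0) !dotZl !mul0r conjc0.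
Qed.

Lemma adj_linear (a : R[i]) S T : adj (a *: S + T) = conjc a *: adj S + adj T.
Proof.
apply: adj_unique => f g.
by rewrite !bopDE !bopZE dotDl dotZl dotDr dotZr conjcK !adjP.
Qed.

Lemma adjM S T : adj (S * T) = adj T * adj S.
Proof. by apply: adj_unique => f g; rewrite !bopME !adjP. Qed.

Lemma opnorm_adj T : opnorm (adj T) = opnorm T.
Proof.
have le S : opnorm (adj S) <= opnorm S.
  apply: opnorm_le (opnorm_ge0 _) _ => f.
  have [f0|f0] := eqVneq (l2norm (adj S f)) 0.
    by rewrite f0 mulr_ge0 ?opnorm_ge0 ?l2norm_ge0.
  have fp : 0 < l2norm (adj S f) by rewrite lt_neqAle eq_sym f0 l2norm_ge0.
  rewrite -(ler_pM2r fp) -expr2.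
  have := cauchy_schwarz (S (adj S f)) f.
  rewrite adjP dotE /= expr0n addr0 sqrtr_sqr ger0_norm ?sqr_ge0// => /le_trans; apply.
  by rewrite mulrAC ler_wpM2r ?l2norm_ge0 ?opnormP.
by apply/eqP; rewrite eq_le le/= -{1}(adjK T) le.
Qed.

Lemma opnormM S T : opnorm (S * T) <= opnorm S * opnorm T.
Proof.
apply: opnorm_le => [|f]; first by rewrite mulr_ge0 ?opnorm_ge0.
by rewrite bopME (le_trans (opnormP _ _))// -mulrA ler_wpM2l ?opnorm_ge0 ?opnormP.
Qed.

Lemma opnormD S T : opnorm (S + T) <= opnorm S + opnorm T.
Proof. by have := ler_normD S T; rewrite !bop_normE addcE lecE => /andP[]. Qed.

Lemma closure_opnormP A T :
  closure A T <-> forall e : R, 0 < e -> exists2 S, A S & opnorm (T - S) < e.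
Proof.
split=> [cA e e0|h D].
  have [|S [AS]] := cA (ball T (Complex e 0)).
    by apply: nbhsx_ballx; rewrite ltcE/= eqxx.
  by rewrite -ball_normE /= bop_normE ltcE => /andP[_ ?]; exists S.
move=> /nbhs_ballP[[e i]]/=; rewrite ltcE/= => /andP[/eqP -> e0] TD.
have [S AS Se] := h e e0; exists S; split=> //; apply: TD.
by rewrite -ball_normE /= bop_normE ltcE/= eqxx.
Qed.

Lemma closure_cstar A : star_subalgebra A -> cstar_subalgebra (closure A).
Proof.
move=> [A0 AL AM AJ]; split; last exact: closed_closure.
split.
- exact: subset_closure.
- move=> a S T /closure_opnormP cS /closure_opnormP cT.
  apply/closure_opnormP => e e0; have e2 : 0 < e / 2 by rewrite divr_gt0.
  have p : 0 < normc a + 1 by rewrite ltr_wpDl ?normc_ge0.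
  have [S' AS' hS] := cS (e / 2 / (normc a + 1)) (divr_gt0 e2 p).
  have [T' AT' hT] := cT (e / 2) e2.
  exists (a *: S' + T'); first exact: AL.
  rewrite opprD addrACA -scalerBr (le_lt_trans (opnormD _ _))// opnormZ.
  rewrite ltr_pdivlMr// in hS.
  have := opnorm_ge0 (S - S'); have := normc_ge0 a; nra.
- move=> S T /closure_opnormP cS /closure_opnormP cT.
  apply/closure_opnormP => e e0; have e2 : 0 < e / 2 by rewrite divr_gt0.
  have p : 0 < opnorm S + 1 by rewrite ltr_wpDl ?opnorm_ge0.
  have [T' AT' hT] := cT (e / 2 / (opnorm S + 1)) (divr_gt0 e2 p).
  have q : 0 < opnorm T' + 1 by rewrite ltr_wpDl ?opnorm_ge0.
  have [S' AS' hS] := cS (e / 2 / (opnorm T' + 1)) (divr_gt0 e2 q).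
  exists (S' * T'); first exact: AM.
  have -> : S * T - S' * T' = S * (T - T') + (S - S') * T'.
    by rewrite mulrBr mulrBl addrA subrK.
  rewrite (le_lt_trans (opnormD _ _))//.
  have h1 := opnormM S (T - T'); have h2 := opnormM (S - S') T'.
  rewrite ltr_pdivlMr// in hS; rewrite ltr_pdivlMr// in hT.
  have := opnorm_ge0 (S - S'); have := opnorm_ge0 (T - T').
  have := opnorm_ge0 S; have := opnorm_ge0 T'; nra.
- move=> T /closure_opnormP cT; apply/closure_opnormP => e e0.
  have [S AS hS] := cT e e0; exists (adj S); first exact: AJ.
  rewrite -opnorm_adj.
  suff -> : adj (adj T - adj S) = T - S by [].
  rewrite addrC -scaleN1r adj_linear !adjK.
  by rewrite rmorphN rmorph1 scaleN1r addrC.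
Qed.

End cstar_algebras.

Section partial_translations.
Context (R : realType) (X : choiceType).

Record partial_bijection := PartialBijection {
  pb_graph :> set (X * X) ;
  pb_fst_inj : set_inj pb_graph fst ;
  pb_snd_inj : set_inj pb_graph snd }.

Record is_metric (d : X -> X -> R) : Prop := IsMetric {
  is_metric_ge0 : forall x y, 0 <= d x y ;
  is_metric_eq0 : forall x y, d x y = 0 <-> x = y ;
  is_metric_sym : forall x y, d x y = d y x ;
  is_metric_triangle : forall x y z, d x z <= d x y + d y z }.

(* Properness of a metric inducing the discrete topology: closed balls, being
   compact and discrete, are finite. *)
Definition proper_metric (d : X -> X -> R) : Prop :=
  forall x r, finite_set [set y | d x y <= r].

Definition partial_translation (d : X -> X -> R) : set partial_bijection :=
  [set t | exists r, forall p, pb_graph t p -> d p.1 p.2 <= r].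

(* The matrix coefficient T(x, y) of an operator is T (delta y) x. *)
Definition propagation_le (d : X -> X -> R) (r : R) : set (bop R X) :=
  [set T : bop R X | forall x y, r < d x y -> T (delta y) x = 0].

Definition uniform_roe (d : X -> X -> R) : set (bop R X) :=
  closure [set T : bop R X | exists r : R, propagation_le d r T].

Section pullback.
Variables (s : X -> option X).
Hypothesis s_inj : forall x x' y, s x = Some y -> s x' = Some y -> x = x'.

Let pull_fun (f : X -> R[i]) : X -> R[i] :=
  fun x => if s x is Some y then f y else 0.

Let pull_sum (f : l2 R X) (r : seq X) : uniq r ->
  \sum_(x <- r) normc (pull_fun f x) ^+ 2 <= l2norm f ^+ 2.
Proof.
move=> ur; rewrite sqr_l2norm.
have -> : \sum_(x <- r) normc (pull_fun f x) ^+ 2 =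
          \sum_(y <- pmap s r) normc (f y) ^+ 2.
  elim: {ur} r => [|x r IH]; first by rewrite !big_nil.
  rewrite big_cons IH /pull_fun /=; case: (s x) => [y|] /=.
    by rewrite big_cons.
  by rewrite expr0n addr0 sqrtr0 expr0n add0r.
apply: rsum_ge_seq (l2_summable f) _ => [x|]; first exact: sqr_ge0.
elim: r ur => [//|x r IH] /= /andP[xr /IH ur]; case sx: (s x) => [y|//] /=.
rewrite ur andbT mem_pmap; apply/mapP => -[x' x'r /esym sx'].
by rewrite (s_inj sx sx') x'r in xr.
Qed.

Let pull_subproof (f : l2 R X) : pull_fun f \in @l2_pred R X.
Proof.
rewrite inE; apply: rsummable_bound (@pull_sum f) => x; exact: sqr_ge0.
Qed.

Let pull_l2 (f : l2 R X) : l2 R X := L2 (pull_subproof f).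

Let pull_bop_subproof : pull_l2 \in @bop_pred R X.
Proof.
rewrite inE; split=> [a u v|].
  apply: l2_ext => x; rewrite l2DE l2ZE /= /pull_fun.
  by case: (s x) => [y|]; rewrite ?mulr0 ?addr0.
exists 1 => f; rewrite mul1r.
rewrite -(@ler_pXn2r _ 2)// ?nnegrE ?l2norm_ge0//.
rewrite sqr_l2norm; apply: rsum_le_bound (@pull_sum f) => x; exact: sqr_ge0.
Qed.

(* The operator f |-> f \o s on l^2(X), for an injective partial map s, the
   result being extended by 0 where s is undefined. *)
Definition pullback : bop R X := Bop pull_bop_subproof.

Lemma pullbackE f x : pullback f x = if s x is Some y then f y else 0.
Proof. by []. Qed.

End pullback.

Section partial_isometry.
Variable t : partial_bijection.

Definition pb_map (x : X) : option X :=
  if pselect (exists y, pb_graph t (x, y)) is left e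
  then Some (projT1 (cid e)) else None.

Lemma pb_mapP x y : pb_map x = Some y <-> pb_graph t (x, y).
Proof.
rewrite /pb_map; case: pselect => [e|n]; last first.
  by split=> // txy; case: n; exists y.
case: cid => z /= txz; split=> [[<-]//|txy].
have := @pb_fst_inj t (x, z) (x, y); rewrite !inE /=.
by move=> /(_ txz txy erefl) [->].
Qed.

Lemma pb_map_inj x x' y : pb_map x = Some y -> pb_map x' = Some y -> x = x'.
Proof.
move=> /pb_mapP txy /pb_mapP tx'y.
have := @pb_snd_inj t (x, y) (x', y); rewrite !inE /=.
by move=> /(_ txy tx'y erefl) [->].
Qed.

(* t as a partial isometry, sending delta y to delta x if (x, y) is in t, and
   to 0 if there is no such x: see pb_op_delta and pb_op_delta0. *)
Definition pb_op : bop R X := pullback pb_map_inj.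

Lemma pb_op_delta x y : pb_graph t (x, y) -> pb_op (delta y) = delta x.
Proof.
move=> txy; apply: l2_ext => z; rewrite pullbackE deltaE.
case sz: (pb_map z) => [w|]; last first.
  by case: eqP => [zx|//]; move: sz; rewrite zx (pb_mapP x y).2.
rewrite deltaE (_ : (w == y) = (z == x))//; apply/eqP/eqP => e.
  by apply: (pb_map_inj sz); rewrite e; apply/pb_mapP.
by move: sz; rewrite e (pb_mapP x y).2// => -[].
Qed.

Lemma pb_op_delta0 y : ~ (exists x, pb_graph t (x, y)) -> pb_op (delta y) = 0.
Proof.
move=> nt; apply: l2_ext => z; rewrite pullbackE.
case sz: (pb_map z) => [w|//]; rewrite deltaE.
by case: eqP => [wy|//]; case: nt; exists z; apply/pb_mapP; rewrite -wy.
Qed.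

End partial_isometry.

Definition ptrans_algebra (d : X -> X -> R) (TT : set partial_bijection) :
  set (bop R X) := cstar_generated (uniform_roe d) (pb_op @` TT).

End partial_translations.

Section uniform_roe_algebra.
Context (R : realType) (X : choiceType) (d : X -> X -> R).

Lemma pb_op_uniform_roe (t : partial_bijection X) :
  partial_translation d t -> uniform_roe d (pb_op R t).
Proof.
move=> [r tr]; apply: subset_closure; exists r => x y rd; rewrite pullbackE.
case tx: (pb_map t x) => [z|//]; rewrite deltaE; case: eqP => [zy|//].
by move: tx => /pb_mapP /tr /=; rewrite zy leNgt rd.
Qed.

Lemma uniform_roe_cstar : is_metric d -> cstar_subalgebra (uniform_roe d).
Proof.
move=> md; apply: closure_cstar; split.
- by exists 0.
- move=> a S T [r Sr] [q Tq]; exists (Num.max r q) => x y.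
  rewrite gt_max => /andP[xr xq].
  by rewrite bopDE bopZE l2DE l2ZE Sr// Tq// mulr0 addr0.
- move=> S T [r Sr] [q Tq]; exists (r + q) => x y xy.
  rewrite bopME -dot_delta adjP /dot (@csum_fin _ _ _ [::]) ?big_nil// => z _.
  rewrite -[adj S (delta x) z]dot_delta dotC conjcK -adjP dot_delta.
  have [dyz|dyz] := ltP r (d x z); first by rewrite Sr ?mulr0.
  rewrite Tq ?mul0r//; have := is_metric_triangle md x z y; lra.
- move=> T [r Tr]; exists r => x y xy.
  rewrite -dot_delta dotC -adjP dot_delta Tr ?conjc0//.
  by rewrite (is_metric_sym md).
Qed.

End uniform_roe_algebra.

Section group_algebras.
Context (R : realType) (G : groupType).

Definition left_invariant (d : G -> G -> R) : Prop :=
  forall g x y, d (g * x)%g (g * y)%g = d x y.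

Section translation.
Variable g : G.

Let transl_graph : set (G * G) := [set p | p.2 = (p.1 * g)%g].

Let transl_fst_inj : set_inj transl_graph fst.
Proof. by move=> [x y] [x' y'] /set_mem; rewrite /transl_graph/= => -> /set_mem/= -> /= ->. Qed.

Let transl_snd_inj : set_inj transl_graph snd.
Proof. by move=> [x y] [x' y'] /set_mem; rewrite /transl_graph/= => -> /set_mem/= -> /= /mulIg ->. Qed.

Definition translation : partial_bijection G :=
  PartialBijection transl_fst_inj transl_snd_inj.

End translation.

Lemma translationE g x y : pb_graph (translation g) (x, y) <-> y = (x * g)%g.
Proof. by []. Qed.

Definition translations_lt (d : G -> G -> R) (r : R) : set (partial_bijection G) :=
  [set translation g | g in [set g | d 1%g g < r]].

Definition canonical_structure (d : G -> G -> R) : set (partial_bijection G) :=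
  \bigcup_(r in [set r : R | 0 < r]) translations_lt d r.

Lemma canonical_structure_translation d : left_invariant d ->
  canonical_structure d `<=` partial_translation d.
Proof.
move=> di _ [r _ [g _ <-]]; exists (d 1%g g) => -[x y] /translationE ->/=.
by rewrite -{1}(mulg1 x) di.
Qed.

Lemma lreg_subproof (g x x' y : G) :
  Some (g^-1 * x)%g = Some y -> Some (g^-1 * x')%g = Some y -> x = x'.
Proof. by move=> [<-] [e]; apply: (can_inj (mulKg g^-1%g)); rewrite e. Qed.

(* Left translation by g on l^2(G), sending delta x to delta (g x). *)
Definition lreg g : bop R G := pullback R (@lreg_subproof g).

Lemma lregE g f x : lreg g f x = f (g^-1 * x)%g. Proof. by []. Qed.

Lemma lreg_delta g x : lreg g (delta x) = delta (g * x)%g.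
Proof.
apply: l2_ext => y; rewrite lregE !deltaE.
by rewrite (_ : (g^-1 * y == x)%g = (y == g * x)%g)//; apply/eqP/eqP => [<-|->];
   rewrite ?mulVKg ?mulKg.
Qed.

Lemma lregM g h : lreg (g * h)%g = lreg g * lreg h.
Proof.
apply: bop_ext => f; apply: l2_ext => x.
by rewrite lregE bopME !lregE invgM mulgA.
Qed.

Lemma lreg1 : lreg 1%g = 1.
Proof. by apply: bop_ext => f; apply: l2_ext => x; rewrite lregE invg1 mul1g. Qed.

Lemma adj_lreg g : adj (lreg g) = lreg g^-1%g.
Proof.
apply: bop_ext => f; apply: l2_ext => x.
by rewrite -dot_delta dotC -adjP -dotC lreg_delta dot_delta lregE invgK.
Qed.

(* The image of the complex group ring under the left regular representation. *)
Definition group_ring_image : set (bop R G) :=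
  [set T | exists s : seq (R[i] * G), T = \sum_(p <- s) p.1 *: lreg p.2].

Lemma group_ring_image_star : star_subalgebra group_ring_image.
Proof.
have L a S T : group_ring_image S -> group_ring_image T ->
    group_ring_image (a *: S + T).
  move=> [s ->] [s' ->]; exists ([seq (a * p.1, p.2) | p <- s] ++ s').
  rewrite big_cat big_map scaler_sumr/=; congr (_ + _).
  by apply: eq_bigr => p _; rewrite scalerA.
have Z : group_ring_image 0 by exists [::]; rewrite big_nil.
have sc a S : group_ring_image S -> group_ring_image (a *: S).
  by move=> iS; rewrite -[_ *: _]addr0; exact: L.
split=> //.
- move=> _ T [s ->] [s' ->]; rewrite mulr_suml.
  elim: s => [|p s IH]; first by rewrite big_nil.
  rewrite big_cons -[X in X + _]scale1r; apply: L => //.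
  exists [seq (p.1 * q.1, (p.2 * q.2)%g) | q <- s'].
  rewrite big_map mulr_sumr; apply: eq_bigr => q _ /=; rewrite lregM.
  by apply: bop_ext => f; rewrite !(bopME, bopZE) linearZ/= scalerA.
- move=> _ [s ->]; exists [seq (conjc p.1, p.2^-1%g) | p <- s].
  elim: s => [|p s IH]; first by rewrite !big_nil adj0.
  by rewrite /= !big_cons adj_linear adj_lreg IH.
Qed.

Definition reduced_cstar : set (bop R G) := closure group_ring_image.

Lemma reduced_cstarP : cstar_subalgebra reduced_cstar.
Proof. exact: closure_cstar group_ring_image_star. Qed.

End group_algebras.

Arguments reduced_cstar : clear implicits.

(* Main.v *)
Require Import Defs.
From mathcomp Require Import all_boot all_order all_algebra.
From mathcomp Require Import boolp classical_sets functions cardinality reals.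
From mathcomp Require Import complex topology.

(** The partial translation t_g sends f to x |-> f (x g): it is right
    translation, whereas the generators of the reduced group algebra are the
    left translations f |-> (x |-> f (g^-1 x)).  Inversion on G exchanges right
    and left multiplication, so conjugation by the self-adjoint unitary
    U f x = f x^-1 sends t_g exactly to the left translation by g
    ([conj_translation]).

    Conjugation by a unitary is a multiplicative, *-preserving and continuous
    bijection of the bounded operators, so preimages of C*-subalgebras under it
    are C*-subalgebras ([cstar_conj_preim]).  Both algebras being the smallest
    C*-algebras that contain their generators, matching the generators is
    enough:
    - the operators of the uniform Roe algebra that are conjugated into the
      reduced group algebra form a C*-algebra containing every t_g, hence
      containing C*(T);
    - for any C*-algebra E containing every t_g, the operators conjugated back
      into E form a C*-algebra containing every left translation, hence the
      reduced group algebra ([reduced_cstar_min]). *)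

Set Implicit Arguments.
Unset Strict Implicit.
Unset Printing Implicit Defensive.

Import Order.TTheory GRing.Theory Num.Theory.

Local Open Scope classical_set_scope.
Local Open Scope ring_scope.

Section conjugation.
Context {R : realType} {X : choiceType}.
Implicit Types (S T U : bop R X) (A D : set (bop R X)).

Definition conj_op U T : bop R X := U * T * adj U.

Lemma bop_mulrZ (a : R[i]) S T : S * (a *: T) = a *: (S * T).
Proof. by apply: bop_ext => f; rewrite !(bopME, bopZE) linearZ. Qed.

Lemma bop_mulZr (a : R[i]) S T : (a *: S) * T = a *: (S * T).
Proof. exact: bop_ext. Qed.

Lemma conj_op_linear U (a : R[i]) S T :
  conj_op U (a *: S + T) = a *: conj_op U S + conj_op U T.
Proof. by rewrite /conj_op mulrDr mulrDl bop_mulrZ bop_mulZr. Qed.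

Lemma conj_opB U S T : conj_op U (S - T) = conj_op U S - conj_op U T.
Proof. by rewrite /conj_op mulrBr mulrBl. Qed.

Lemma conj_op0 U : conj_op U 0 = 0.
Proof. by rewrite /conj_op mulr0 mul0r. Qed.

Lemma conj_op_adj U T : conj_op U (adj T) = adj (conj_op U T).
Proof. by rewrite /conj_op !adjM adjK mulrA. Qed.

Lemma unitary_adj U : unitary U -> unitary (adj U).
Proof. by case=> UV VU; split; rewrite adjK. Qed.

Lemma conj_opM U S T : unitary U ->
  conj_op U (S * T) = conj_op U S * conj_op U T.
Proof.
case=> _ VU; rewrite /conj_op !mulrA; congr (_ * _ * _).
by rewrite -[U * S * _ * _]mulrA VU mulr1.
Qed.

Lemma conj_opK U : unitary U -> cancel (conj_op U) (conj_op (adj U)).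
Proof.
by case=> _ VU T; rewrite /conj_op adjK !mulrA VU mul1r -mulrA VU mulr1.
Qed.

Lemma conj_opVK U : unitary U -> cancel (conj_op (adj U)) (conj_op U).
Proof. by move=> uU T; rewrite -{1}(adjK U) conj_opK//; exact: unitary_adj. Qed.

Lemma opnorm_conj U T : opnorm (conj_op U T) <= opnorm U ^+ 2 * opnorm T.
Proof.
rewrite (le_trans (opnormM _ _))// opnorm_adj expr2 mulrAC.
by rewrite ler_wpM2r ?opnorm_ge0// opnormM.
Qed.

Lemma closed_conj_preim U A : closed A -> closed (conj_op U @^-1` A).
Proof.
move=> cA T /closure_opnormP clT; apply: cA; apply/closure_opnormP => e e0.
(* The added 1 keeps the divisor positive even when U = 0. *)
have K0 : 0 < opnorm U ^+ 2 + 1 by rewrite ltr_wpDl ?sqr_ge0.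
have [S AS] := clT _ (divr_gt0 e0 K0).
rewrite ltr_pdivlMr// mulrC => TS; exists (conj_op U S) => //.
rewrite -conj_opB (le_lt_trans (opnorm_conj _ _))// (le_lt_trans _ TS)//.
by rewrite ler_wpM2r ?opnorm_ge0// lerDl.
Qed.

Lemma cstar_conj_preim U A : unitary U -> cstar_subalgebra A ->
  cstar_subalgebra (conj_op U @^-1` A).
Proof.
move=> uU [[A0 AL AM AJ] cA]; split; last exact: closed_conj_preim.
split=> /=.
- by rewrite conj_op0.
- by move=> a S T AS AT; rewrite conj_op_linear; exact: AL.
- by move=> S T AS AT; rewrite conj_opM//; exact: AM.
- by move=> T AT; rewrite conj_op_adj; exact: AJ.
Qed.

Lemma cstar_subalgebraI A D : cstar_subalgebra A -> cstar_subalgebra D ->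
  cstar_subalgebra (A `&` D).
Proof.
move=> [[A0 AL AM AJ] cA] [[D0 DL DM DJ] cD]; split; last exact: closedI.
split=> //.
- by move=> a S T [AS DS] [AT DT]; split; [exact: AL|exact: DL].
- by move=> S T [AS DS] [AT DT]; split; [exact: AM|exact: DM].
- by move=> T [AT DT]; split; [exact: AJ|exact: DJ].
Qed.

Lemma star_isomorphism_conj U A D : unitary U ->
  (forall T, A T -> D (conj_op U T)) ->
  (forall T, D T -> A (conj_op (adj U) T)) ->
  star_isomorphism A D (conj_op U).
Proof.
move=> uU AD DA; split.
- split=> // [S T _ _ /(can_inj (conj_opK uU))//|T DT].
  by exists (conj_op (adj U) T); [exact: DA|exact: conj_opVK].
- by move=> a S T _ _; exact: conj_op_linear.
- by move=> S T _ _; exact: conj_opM.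
- by move=> T _; exact: conj_op_adj.
Qed.

End conjugation.

Section groups.
Context (R : realType) (G : groupType).

Lemma inv_op_subproof (x x' y : G) :
  Some x^-1%g = Some y -> Some x'^-1%g = Some y -> x = x'.
Proof. by move=> [<-] [/invg_inj]. Qed.

Definition inv_op : bop R G := pullback R inv_op_subproof.

Lemma inv_opE f x : inv_op f x = f x^-1%g. Proof. by []. Qed.

Lemma inv_op_delta (g : G) : inv_op (delta g) = delta g^-1%g.
Proof.
apply: l2_ext => x; rewrite inv_opE !deltaE.
by rewrite -(inj_eq invg_inj) invgK.
Qed.

Lemma adj_inv_op : adj inv_op = inv_op.
Proof.
apply: bop_ext => f; apply: l2_ext => x.
by rewrite -dot_delta dotC -adjP -dotC inv_op_delta dot_delta.
Qed.

Lemma unitary_inv_op : unitary inv_op.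
Proof.
by split; rewrite adj_inv_op; apply: bop_ext => f; apply: l2_ext => x;
  rewrite bopME !inv_opE invgK.
Qed.

Lemma translation_opE (g : G) (f : l2 R G) x :
  pb_op R (translation g) f x = f (x * g)%g.
Proof.
by rewrite pullbackE ((pb_mapP (translation g) x (x * g)%g).2 erefl).
Qed.

(** With x replaced by x^-1 and the result inverted, the right translation
    x |-> x g becomes x |-> (x^-1 g)^-1 = g^-1 x. *)
Lemma conj_translation (g : G) :
  conj_op inv_op (pb_op R (translation g)) = lreg R g.
Proof.
apply: bop_ext => f; apply: l2_ext => x.
by rewrite /conj_op adj_inv_op !bopME inv_opE translation_opE inv_opE lregE
  invgM invgK.
Qed.

Lemma reduced_cstar_min (E : set (bop R G)) : cstar_subalgebra E ->
  (forall g, E (lreg R g)) -> reduced_cstar R G `<=` E.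
Proof.
move=> [[E0 EL _ _] cE] Eg T rT; apply: cE; apply: closure_subset T rT => _ [s ->].
by elim: s => [|p s IH]; [rewrite big_nil|rewrite big_cons; exact: EL].
Qed.

Lemma canonical_translation (d : G -> G -> R) (g : G) : is_metric d ->
  canonical_structure d (translation g).
Proof.
move=> md; exists (d 1%g g + 1); last by exists g => //=; rewrite ltrDl.
by rewrite /= ltr_wpDl// is_metric_ge0.
Qed.

Lemma conj_ptrans_algebra (d : G -> G -> R) : is_metric d -> left_invariant d ->
  forall T, ptrans_algebra d (canonical_structure d) T ->
    reduced_cstar R G (conj_op inv_op T).
Proof.
move=> md di T /(_ (uniform_roe d `&` conj_op inv_op @^-1` reduced_cstar R G)).
case=> //; split.
- apply: cstar_subalgebraI; first exact: uniform_roe_cstar.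
  exact: cstar_conj_preim unitary_inv_op (reduced_cstarP _ _).
- exact: subIsetl.
- move=> _ [t ct <-]; split.
    exact/pb_op_uniform_roe/canonical_structure_translation.
  have [_ _ [g _ <-]] := ct; rewrite /= conj_translation.
  by apply: subset_closure; exists [:: (1, g)]; rewrite big_seq1 scale1r.
Qed.

Lemma conj_reduced_cstar (d : G -> G -> R) : is_metric d ->
  forall T, reduced_cstar R G T ->
    ptrans_algebra d (canonical_structure d) (conj_op (adj inv_op) T).
Proof.
move=> md T rT E [cE _ genE]; apply: (@reduced_cstar_min
  (conj_op (adj inv_op) @^-1` E) _ _ T rT) => [|g].
  exact/cstar_conj_preim/cE/unitary_adj/unitary_inv_op.
rewrite /= -conj_translation (conj_opK unitary_inv_op); apply: genE.
by exists (translation g) => //; exact: canonical_translation.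
Qed.

End groups.

Theorem theorem27 (R : realType) (G : groupType) (d : G -> G -> R)
    (G_countable : countable [set: G])
    (d_metric : is_metric d)
    (d_left_invariant : left_invariant d)
    (d_proper : proper_metric d) :
  exists U : bop R G,
    [/\ unitary U,
        forall g : G, U (delta g) = delta g^-1%g &
        star_isomorphism
          (ptrans_algebra d (canonical_structure d))
          (reduced_cstar R G)
          (fun T : bop R G => U * T * adj U)].
Proof.
exists (inv_op R G); split.
- exact: unitary_inv_op.
- exact: inv_op_delta.
- apply: star_isomorphism_conj (unitary_inv_op R G) _ _.
    exact: conj_ptrans_algebra.
  exact: conj_reduced_cstar.
Qed.
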